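(* Let $S=S(\lambda_1,\ldots,\lambda_d)$ be an $n$-vertex spider with $(\lambda_1,\ldots,\lambda_d)$ a partition. If at least one of the following three criteria holds, then $S$ is not $e$-positive. (1) $\lambda_1 \geq \lambda_2+\cdots+\lambda_d$, $\lambda_2 \leq \lambda_3+\cdots+\lambda_d$, $\lambda_2\geq 2$, and either $\lambda_2\geq 3$, or $\lambda_2=2$ and $q\geq 3$, where $n=q(\lambda_2+1)+r$ with integers $q, r$ and $0\leq r<\lambda_2+1$. (2) There is an integer $i$ with $3\leq i<d$ such that $\lambda_i\geq 2$, $\lambda_i\leq\lambda_{i+1}+\cdots+\lambda_d$, and $\lambda_j>\lambda_{j+1}+\cdots+\lambda_d$ for all $j<i$. (3) There is an integer $i$ with $2\leq i<d$ such that $t=\lambda_{i+1}+\cdots+\lambda_d>1$ and $q\geq\frac{\lambda_i+1}{t-1}$, where $n=q(\lambda_i+1)+r$ with integers $q, r$ and $0\leq r<\lambda_i+1$.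
   Context: Given a partition $\lambda=(\lambda_1\ge\cdots\ge\lambda_d>0)$ of $n-1$ with $d\ge 3$ parts, the spider $S(\lambda_1,\ldots,\lambda_d)$ is the $n$-vertex tree consisting of $d$ disjoint paths $P_{\lambda_1},\ldots,P_{\lambda_d}$ (the legs), where $P_k$ denotes the path with $k$ vertices, together with one further vertex (the centre) joined to one end vertex of each path. Chromatic symmetric function and $e$-positivity: a proper colouring of a graph $G$ is a map $\kappa:V_G\to\{1,2,\ldots\}$ with $\kappa(u)\neq\kappa(v)$ whenever $u,v$ are adjacent. If $V_G=\{v_1,\ldots,v_n\}$, the chromatic symmetric function is $X_G=\sum_\kappa x_{\kappa(v_1)}\cdots x_{\kappa(v_n)}\in\mathbb{Q}[[x_1,x_2,\ldots]]$, summed over all proper colourings $\kappa$ of $G$. The elementary symmetric functions are $e_i=\sum_{j_1<\cdots<j_i}x_{j_1}\cdots x_{j_i}$ for $i\ge 1$ and $e_\lambda=e_{\lambda_1}\cdots e_{\lambda_\ell}$ for a partition $\lambda=(\lambda_1,\ldots,\lambda_\ell)$; they form a basis of the algebra of symmetric functions over $\mathbb{Q}$. The graph $G$ is $e$-positive if $X_G$ is a nonnegative linear combination of the $e_\lambda$. *)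

(* Defs.v *)
From HB Require Import structures.
From mathcomp Require Import all_boot all_order all_algebra.
From mathcomp Require Import finmap multiset.
From mathcomp Require Import boolp classical_sets functions cardinality fsbigop.

Set Implicit Arguments.
Unset Strict Implicit.
Unset Printing Implicit Defensive.
Import Order.TTheory GRing.Theory Num.Theory.
Local Open Scope classical_set_scope.
Local Open Scope mset_scope.
Local Open Scope ring_scope.

Record sgraph := SGraph {
  vertex :> finType;
  adj : rel vertex;
  adj_sym : symmetric adj;
  adj_irrefl : irreflexive adj }.

(* A monomial in the variables x_0, x_1, ... is the multiset of the indices of
   its variables: x_j has exponent m j.  A power series over rat is the function
   giving its coefficients.  Variables and colours are indexed from 0. *)
Definition monomial := {mset nat}.
Definition series := monomial -> rat.

(* The series \sum_(t in A) x^(mu t), for a possibly infinite set A on which mu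
   has finite fibres; the sums below, over a classical set, are then finite. *)
Definition monomial_sum (T : choiceType) (A : set T) (mu : T -> monomial) :
    series :=
  fun m => \sum_(t \in [set t | A t /\ mu t = m]) (1 : rat).

Definition series1 : series := fun m => (m == mset0)%:R.

(* Cauchy product: multiplication of monomials is the sum of multisets, so every
   m has finitely many factorisations. *)
Definition series_mul (F G : series) : series :=
  fun m => \sum_(p \in [set p : monomial * monomial | msetD p.1 p.2 = m])
    F p.1 * G p.2.

Definition proper_colouring (G : sgraph) (k : {ffun G -> nat}) : Prop :=
  forall u v : G, adj u v -> k u <> k v.

Definition chromatic (G : sgraph) : series :=
  monomial_sum [set k : {ffun G -> nat} | proper_colouring k]
    (fun k => seq_mset [seq k v | v <- enum G]).

Definition elementary (i : nat) : series :=
  monomial_sum [set J : {fset nat} | #|` J| = i]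
    (fun J => seq_mset (enum_fset J)).

Definition elementary_prod (la : seq nat) : series :=
  foldr series_mul series1 [seq elementary i | i <- la].

Definition is_partition (la : seq nat) : bool :=
  sorted geq la && all (ltn 0) la.

Definition e_positive (G : sgraph) : Prop :=
  exists (P : {fset seq nat}) (c : seq nat -> rat),
    (forall mu, mu \in P -> is_partition mu /\ 0 <= c mu) /\
    (forall m : monomial,
       chromatic G m = \sum_(mu <- P) c mu * elementary_prod mu m).

(* The i-th part, for 1 <= i <= size la. *)
Definition part (la : seq nat) (i : nat) : nat := nth 0%N la i.-1.

(* lambda_(i+1) + ... + lambda_d, with d = size la. *)
Definition part_tail (la : seq nat) (i : nat) : nat :=
  (\sum_(i.+1 <= j < (size la).+1) part la j)%N.

(* None is the centre; Some (Tagged _ j), with tag k, is the j-th vertex of the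
   k-th leg (both from 0), the vertex j = 0 being the one next to the centre. *)
Definition spider_vertex (la : seq nat) : finType :=
  option {k : 'I_(size la) & 'I_(nth 0%N la k)}.

Definition spider_adj (la : seq nat) : rel (spider_vertex la) :=
  fun u v => match u, v with
  | None, None => false
  | None, Some x | Some x, None => tagged x == 0 :> nat
  | Some x, Some y => (tag x == tag y) &&
      (((tagged x).+1 == tagged y :> nat) || ((tagged y).+1 == tagged x :> nat))
  end.

Lemma spider_adj_sym (la : seq nat) : symmetric (@spider_adj la).
Proof. by case=> [x|] [y|] //=; rewrite eq_sym orbC. Qed.

Lemma spider_adj_irrefl (la : seq nat) : irreflexive (@spider_adj la).
Proof. by case=> [x|] //=; rewrite eqxx orbb -[X in _ == X]addn0 -addn1 eqn_add2l. Qed.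

Definition spider (la : seq nat) : sgraph :=
  SGraph (@spider_adj_sym la) (@spider_adj_irrefl la).

(* Main.v *)
Require Import Defs.
From mathcomp Require Import all_boot all_order all_algebra all_field.
From mathcomp Require Import finmap multiset.
From mathcomp Require Import boolp classical_sets fsbigop.
From mathcomp Require Import zify.
Import Order.TTheory GRing.Theory Num.Theory.

(** A symmetric function can be evaluated on a finite alphabet [x_0, ..., x_(n-1)]
of complex numbers.  The idea is to choose alphabets whose power sums
[p_1, ..., p_n] are as prescribed, and to compare the two evaluations of the
degree [n] part of [X_S]: as a combination of the [e_mu], and as a sum over
colourings.

Given a set [K] of positive integers, put [(-1)^(k-1) p_k = 1] if [k] is in [K]
and [0] otherwise.  Newton's identities turn this into
[k e_k = sum of the e_(k-j) over the j <= k in K], so that every [e_k] is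
nonnegative, and [e_n > 0] as soon as [n] is a sum of elements of [K].  Over an
algebraically closed field an alphabet of [n] letters with these [e_1, ..., e_n]
exists: its letters are read off the roots of the polynomial with coefficients
[e_k] ([spec_alphabet], [spec_power_sum]).

The colourings of a spider are summed along its legs.  With [W_k(c)] the sum over
the colourings of a leg of [k] vertices attached to a centre of colour [c], one
has [W_(k+1)(c) = P_(k+1) - x_c W_k(c)], where [P_k] is the evaluation of the
chromatic symmetric function of the path with [k] vertices.  Hence [W_k(c)] is a
polynomial in [x_c] of degree at most [k], and [X_S] becomes
[sum_c x_c prod_l W_(lambda_l)(c)], a combination of the power sums
[p_1, ..., p_n].  If [p_1 = ... = p_a = 0] then [P_1 = ... = P_a = 0], so a leg
of [k <= a] vertices contributes exactly [(-x_c)^k].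

Now let [a = lambda_i] and [t = lambda_(i+1) + ... + lambda_d].  With
[K = {a+1, ..., a+t}], the legs [i, ..., d] contribute [(-x_c)^(a+t)], so only
the power sums [p_k] with [k > a+t] occur in [X_S], and they all vanish up to
[k = n].  Thus [X_S] evaluates to [0].  If [n] is a sum of [q] elements of [K],
that is if [q (a+1) <= n <= q (a+t)], then [e_n > 0], and since all the terms
[c_mu e_mu] are nonnegative, the coefficient [c_(n)] is [0]
([spider_not_e_positive]).  This contradicts the second choice [K = {n}]: there
[e_1 = ... = e_(n-1) = 0], so the [e]-expansion reduces to [c_(n) e_n], while
[X_S] evaluates to [(-1)^(n-1) p_n = 1].

Each of the three criteria provides [i] and [q] with
[q (a+1) <= n <= q (a+t)]: writing [n = q (a+1) + r] with [r <= a], this asks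
for [r <= q (t-1)], which is what (3) gives, and which (1) and (2) give because
[2 <= a <= t] and the length of the first leg forces [q >= 2]. *)

Set Implicit Arguments.
Unset Strict Implicit.
Unset Printing Implicit Defensive.
Local Open Scope classical_set_scope.
Local Open Scope mset_scope.
Local Open Scope ring_scope.

(** * Newton's identities *)

Lemma deriv_prod (R : comNzRingType) (I : finType) (F : I -> {poly R}) :
  (\prod_i F i)^`() = \sum_i (F i)^`() * \prod_(j | j != i) F j.
Proof.
elim: (index_enum I) (index_enum_uniq I) => [|a s IH] /=.
  by rewrite !big_nil derivC.
case/andP=> a_s /IH {}IH.
rewrite !big_cons derivM IH eqxx; congr (_ * _ + _).
  rewrite [LHS]big_seq [RHS]big_seq_cond; apply: eq_bigl => i.
  by case: eqP => [->|]; rewrite ?andbT // (negPf a_s).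
rewrite mulr_sumr big_seq [RHS]big_seq; apply: eq_bigr => i i_s.
rewrite big_cons ifT; first exact: mulrCA.
by apply: contraNneq a_s => ->.
Qed.

Section Newton.
Variables (R : comNzRingType) (n : nat) (x : 'I_n -> R).

Definition power_sum (k : nat) : R := \sum_i x i ^+ k.

Definition elem_sym (k : nat) : R :=
  \sum_(J : {set 'I_n} | #|J| == k) \prod_(i in J) x i.

(** The generating function of the elementary symmetric polynomials. *)
Definition elem_gen : {poly R} := \prod_i (1 + x i *: 'X).

Lemma coef_elem_gen k : elem_gen`_k = elem_sym k.
Proof.
rewrite /elem_gen.
under eq_bigr do rewrite addrC.
rewrite bigA_distr coef_sum /elem_sym [RHS]big_mkcond; apply: eq_bigr => J _.
have -> : \prod_i (if i \in J then x i *: 'X else 1)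
          = (\prod_(i in J) x i) *: 'X^#|J| :> {poly R}.
  rewrite -big_mkcond /=.
  under eq_bigr do rewrite -mul_polyC.
  rewrite big_split /= prodr_const -mul_polyC rmorph_prod //.
rewrite coefZ coefXn eq_sym.
by case: eqP => _; rewrite ?mulr1 ?mulr0.
Qed.

Lemma elem_sym0 : elem_sym 0 = 1.
Proof.
rewrite /elem_sym (big_pred1 finset.set0) ?finset.big_set0 // => J.
by rewrite /= cards_eq0.
Qed.

(** Both sides are the coefficient of ['X^k] in the derivative of [elem_gen]: that
derivative is the sum of the [x_i E_i], where [E_i] omits the factor [i], and
[E_i] is obtained from [elem_gen] by dividing by the power series [1 + x_i X]. *)
Lemma newton_identity k :
  k.+1%:R * elem_sym k.+1
  = \sum_(j < k.+1) (-1) ^+ j * power_sum j.+1 * elem_sym (k - j).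
Proof.
pose E i : {poly R} := \prod_(j | j != i) (1 + x j *: 'X).
have EE i : elem_gen = (1 + x i *: 'X) * E i.
  by rewrite /elem_gen (bigD1 i).
have coefE i m : (E i)`_m = \sum_(j < m.+1) (- x i) ^+ j * elem_sym (m - j).
  elim: m => [|m IH].
    rewrite big_ord1 expr0 mul1r -coef_elem_gen (EE i).
    by rewrite mulrDl mul1r coefD -scalerAl coefZ coefXM mulr0 addr0.
  rewrite big_ord_recl expr0 mul1r subn0.
  under eq_bigr do rewrite lift0 subSS exprS -mulrA.
  rewrite -mulr_sumr -IH -coef_elem_gen (EE i).
  by rewrite mulrDl mul1r coefD -scalerAl coefZ coefXM mulNr addrK.
have derE : elem_gen^`() = \sum_i x i *: E i.
  rewrite deriv_prod; apply: eq_bigr => i _.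
  by rewrite derivD derivZ derivX derivC add0r -scalerAl mul1r.
rewrite mulr_natl -coef_elem_gen -coef_deriv derE coef_sum.
under eq_bigr => i _ do rewrite coefZ coefE mulr_sumr.
rewrite exchange_big; apply: eq_bigr => j _ /=.
rewrite -mulrA [power_sum _ * _]mulr_suml mulr_sumr; apply: eq_bigr => i _.
by rewrite [(- x i) ^+ j]exprNn exprS !mulrA [x i * _]mulrC.
Qed.

End Newton.

(** * Alphabets with prescribed power sums *)

Section Specialisation.
Variables (C : numClosedFieldType) (K : pred nat).

(** [m] is fuel for the strong recursion on [k] of [spec_elemS]. *)
Fixpoint spec_elem_aux (m k : nat) : C :=
  if k isn't k'.+1 then 1 else
  if m isn't m'.+1 then 0 else
  (\sum_(j < k | K j.+1) spec_elem_aux m' (k' - j)) / k%:R.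

(** The value forced on [e_k] by [(-1)^(j-1) p_j = 1] for [j] in [K] and [p_j = 0]
for the other [j].  It is the proportion of the permutations of [k] points all
of whose cycle lengths are in [K], and the coefficient of [z^k] in
[exp (sum of the z^j / j over the j in K)]. *)
Definition spec_elem k := spec_elem_aux k k.

Lemma spec_elem_auxE m k : (k <= m)%N -> spec_elem_aux m k = spec_elem k.
Proof.
elim/ltn_ind: k m => -[|k] IH [|m] //= km; rewrite /spec_elem /=.
congr (_ / _); apply: eq_bigr => j _; rewrite !IH //; lia.
Qed.

Lemma spec_elem0 : spec_elem 0 = 1. Proof. by []. Qed.

Lemma spec_elemS k :
  k.+1%:R * spec_elem k.+1 = \sum_(j < k.+1 | K j.+1) spec_elem (k - j).
Proof.
rewrite mulrC divfK ?pnatr_eq0 //.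
by apply: eq_bigr => j _; exact: spec_elem_auxE (leq_subr _ _).
Qed.

Lemma spec_elem_ge0 k : 0 <= spec_elem k.
Proof.
elim/ltn_ind: k => -[|k] IH; first exact: ler01.
rewrite -(pmulr_rge0 _ (ltr0Sn _ k)) spec_elemS.
by apply: sumr_ge0 => j _; apply: IH; lia.
Qed.

Lemma spec_elem_gt0_add j k :
  (0 < j)%N -> K j -> 0 < spec_elem k -> 0 < spec_elem (j + k).
Proof.
case: j => // j _ Kj k_gt0.
rewrite addSn -(pmulr_rgt0 _ (ltr0Sn _ (j + k))) spec_elemS.
have jP : (j < (j + k).+1)%N by lia.
rewrite (bigD1 (Ordinal jP)) //= addKn ltr_wpDr //.
by apply: sumr_ge0 => i _; apply: spec_elem_ge0.
Qed.

(** An integer between [q a] and [q b] is a sum of [q] integers between [a] and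
[b]. *)
Lemma spec_elem_gt0_sum (a b q n : nat) :
  (0 < a)%N -> (forall j, (a <= j <= b)%N -> K j) ->
  (q * a <= n <= q * b)%N -> 0 < spec_elem n.
Proof.
move=> a_gt0 Kab; elim: q n => [|q IH] n.
  by rewrite !mul0n leqn0 => /eqP->; rewrite spec_elem0.
case/andP; rewrite !mulSn => n_ge n_le.
(* The largest first summand that leaves at least [q a] for the other [q]. *)
pose j := minn b (n - q * a)%N.
have -> : n = (j + (n - j))%N by rewrite /j; lia.
have ab : (a <= b)%N.
  rewrite leqNgt; apply/negP => ba; suff: (q * b <= q * a)%N by lia.
  by rewrite leq_mul2l ltnW ?orbT.
apply: spec_elem_gt0_add; rewrite /j; first lia.
  by apply: Kab; lia.
have qab : (q * a <= q * b)%N by rewrite leq_mul2l ab orbT.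
apply: IH; lia.
Qed.

Lemma spec_elem_eq0 k : (0 < k)%N ->
  (forall j, (0 < j <= k)%N -> ~~ K j) -> spec_elem k = 0.
Proof.
case: k => // k _ K0; apply: (mulfI (x := k.+1%:R)); first by rewrite pnatr_eq0.
rewrite mulr0 spec_elemS big_pred0 // => j; apply/negbTE/K0.
by rewrite /= ltn_ord.
Qed.

(** The polynomial with coefficients [spec_elem k] has degree exactly [n] and
constant term [1].  It splits, with nonzero roots [r], hence it is the product
of the factors [1 - X / r] and the letters are the [- 1 / r]. *)
Lemma spec_alphabet n : (0 < n)%N -> spec_elem n != 0 -> exists x : 'I_n -> C,
  forall k, (k <= n)%N -> elem_sym x k = spec_elem k.
Proof.
move=> n_gt0 en_neq0; pose p := \poly_(k < n.+1) spec_elem k.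
have sz_p : size p = n.+1 by rewrite size_poly_eq.
have lc_p : lead_coef p = spec_elem n by rewrite lead_coefE sz_p coef_poly ltnSn.
have [rs p_rs] := closed_field_poly_normal p; rewrite lc_p in p_rs.
have sz_rs : size rs = n.
  by have := sz_p; rewrite p_rs size_scale // size_prod_XsubC => -[].
have p0 : p.[0] = 1 by rewrite horner_coef0 coef_poly.
have rs_neq0 r : r \in rs -> r != 0.
  move=> r_rs; apply/eqP => r0; have := oner_eq0 C.
  rewrite -p0 p_rs hornerZ (_ : (\prod_(_ <- _) _).[0] = 0) ?mulr0 ?eqxx //.
  by apply/rootP; rewrite root_prod_XsubC -r0.
exists (fun i => - (rs`_i)^-1) => k k_n.
rewrite -coef_elem_gen; suff -> : elem_gen (fun i : 'I_n => - (rs`_i)^-1) = p.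
  by rewrite coef_poly ltnS k_n.
have rsE : rs = [seq rs`_(val i) | i <- index_enum 'I_n].
  rewrite (map_comp (nth 0 rs) val) [index_enum _]unlock -enumT val_enum_ord.
  by rewrite -sz_rs -[LHS](mkseq_nth 0).
have {}rs_neq0 (i : 'I_n) : rs`_i != 0 by rewrite rs_neq0 // mem_nth ?sz_rs.
have {}p_rs :
    p = (spec_elem n * \prod_(i < n) - rs`_i) *: elem_gen (fun i : 'I_n => - (rs`_i)^-1).
  rewrite p_rs {1}rsE big_map -scalerA; congr (_ *: _).
  rewrite -mul_polyC rmorph_prod -big_split /=; apply: eq_bigr => i _.
  by rewrite mulrDr mulr1 mul_polyC scalerA mulrNN divff // scale1r polyCN addrC.
have /(congr1 (horner^~ 0)) := p_rs; rewrite p0 hornerZ [_.[0]]horner_coef0.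
by rewrite coef_elem_gen elem_sym0 mulr1 => c1; rewrite {}[p]p_rs -c1 scale1r.
Qed.

(** Newton's identities determine the power sums from the elementary symmetric
polynomials, and [spec_elemS] is that same recurrence for the wanted power
sums. *)
Lemma spec_power_sum n (x : 'I_n -> C) :
  (forall k, (k <= n)%N -> elem_sym x k = spec_elem k) ->
  forall k, (k < n)%N -> power_sum x k.+1 = (-1) ^+ k * (K k.+1)%:R.
Proof.
move=> xE; elim/ltn_ind => k IH k_n.
have := newton_identity x k; rewrite xE // spec_elemS big_mkcond !big_ord_recr /= subnn.
rewrite spec_elem0 elem_sym0 mulr1.
set s1 := \sum_(_ < _) _; set s2 := \sum_(_ < _) _.
have -> : s1 = s2.
  apply: eq_bigr => j _; have j1 := ltn_ord j.
  have [j2 j3] : (j < n)%N /\ (k - j <= n)%N by lia.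
  rewrite IH // xE // mulrA -expr2 sqrr_sign mul1r.
  by case: (K _); rewrite ?mul1r ?mul0r.
move/addrI => E.
have -> : (K k.+1)%:R = (-1) ^+ k * power_sum x k.+1 by rewrite -E; case: (K _).
by rewrite mulrA -expr2 sqrr_sign mul1r.
Qed.

End Specialisation.

(** * Evaluating series on a finite alphabet *)

Lemma sum_pred1_uniq (V : nmodType) (T : eqType) (r : seq T) (a : T)
    (F : T -> V) :
  uniq r -> a \in r -> \sum_(b <- r | a == b) F b = F a.
Proof.
move=> r_uniq a_r; rewrite big_mkcond (bigD1_seq a) //= eqxx big1 ?addr0 // => b.
by rewrite eq_sym => /negPf->.
Qed.

Section Evaluation.
Variables (C : numFieldType) (n : nat) (x : 'I_n -> C).

Definition monomials (d : nat) : seq monomial :=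
  undup [seq seq_mset [seq val i | i <- val t] | t <- enum {: d.-tuple 'I_n}].

Lemma mem_monomials d (m : {mset nat}) :
  (m \in monomials d) = (size m == d) && all (fun j => j < n)%N m.
Proof.
rewrite mem_undup; apply/mapP/andP => [[t _ ->]|[/eqP sz_m m_lt]].
  have pm := perm_eq_seq_mset [seq val i | i <- t].
  rewrite (perm_size pm) size_map size_tuple eqxx (perm_all _ pm) all_map.
  by split=> //; apply/allP => i _ /=.
have mE : [seq val i | i <- pmap (insub : nat -> option 'I_n) m] = m.
  rewrite (pmap_filter (insubK _)); apply/all_filterP.
  by apply: sub_all m_lt => j j_lt; rewrite insubT.
have sz : size (pmap (insub : nat -> option 'I_n) m) == d.
  by rewrite -(size_map val) mE sz_m.
by exists (Tuple sz); rewrite ?mem_enum //= mE seq_mset_id.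
Qed.

(** The variables beyond the alphabet are set to [0]. *)
Definition var (j : nat) : C := if insub j is Some i then x i else 0.

Definition eval_monomial (m : {mset nat}) : C := \prod_(j <- m) var j.

Lemma eval_monomialD (m1 m2 : {mset nat}) :
  eval_monomial (msetD m1 m2) = eval_monomial m1 * eval_monomial m2.
Proof.
have pm : perm_eq (msetD m1 m2) (m1 ++ m2 : seq nat).
  by apply/allP => a _ /=; rewrite count_cat !count_mem_mset msetE2.
by rewrite /eval_monomial (perm_big _ pm) big_cat.
Qed.

Lemma size_msetD (m1 m2 : {mset nat}) :
  size (msetD m1 m2) = (size m1 + size m2)%N.
Proof.
have pm : perm_eq (msetD m1 m2) (m1 ++ m2 : seq nat).
  by apply/allP => a _ /=; rewrite count_cat !count_mem_mset msetE2.
by rewrite (perm_size pm) size_cat.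
Qed.

(** Evaluation of the homogeneous part of degree [d]; a series has in general no
value on the whole, but each of its homogeneous parts becomes a polynomial. *)
Definition eval (d : nat) (F : series) : C :=
  \sum_(m <- monomials d) ratr (F m) * eval_monomial m.

Definition homogeneous (i : nat) (F : series) :=
  forall m : {mset nat}, F m != 0 -> size m = i.

Lemma eval_series1 d : eval d series1 = (d == 0)%:R.
Proof.
have sz0 : size (mset0 : {mset nat}) = 0 by rewrite enum_mset0.
rewrite /eval; have [->|d_neq0] := eqVneq d 0.
  rewrite (bigD1_seq mset0) ?undup_uniq //=; last first.
    by rewrite mem_monomials sz0 enum_mset0.
  rewrite big1 => [|m /negPf m0]; last by rewrite /series1 m0 rmorph0 mul0r.
  by rewrite /series1 eqxx rmorph1 mul1r addr0 /eval_monomial big_mset0.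
rewrite big1_seq // => m /=; rewrite mem_monomials /series1.
have [->|_] := eqVneq m; last by rewrite rmorph0 mul0r.
by rewrite sz0 eq_sym (negPf d_neq0).
Qed.

(** Homogeneity of [F] leaves a single pair of degrees in the product, so that
no sum over all splittings of [d] is needed. *)
Lemma eval_mul i F G d : homogeneous i F ->
  eval d (series_mul F G) = if (i <= d)%N then eval i F * eval (d - i) G else 0.
Proof.
move=> Fi.
pose M := [seq (m1, m2) | m1 <- monomials i, m2 <- monomials (d - i)].
have M_uniq : uniq M by apply: allpairs_uniq => [||[? ?] [? ?]]; rewrite ?undup_uniq.
have mulE m : m \in monomials d ->
    series_mul F G m = if (i <= d)%N then
      \sum_(p <- M | msetD p.1 p.2 == m) F p.1 * G p.2 else 0.
  rewrite mem_monomials => /andP[/eqP sz_m /allP m_lt]; rewrite /series_mul.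
  case: ifP => i_d; last first.
    apply: fsbig1 => p /= pE; apply/eqP; rewrite mulf_eq0.
    apply/orP; left; apply: contraFT i_d => /Fi.
    by move=> sz1; rewrite -sz_m -pE size_msetD sz1 leq_addr.
  rewrite [RHS]bigfs //; last first.
    move=> [m1 m2] /= /eqP mE m12; apply/eqP; rewrite mulf_eq0.
    apply/orP; left; apply: contraNT m12 => /Fi sz1.
    have m_lt' : all (fun j => (j < n)%N) (m1 : {mset nat})
                 && all (fun j => (j < n)%N) (m2 : {mset nat}).
      by apply/andP; split; apply/allP => j j_m; apply: m_lt;
         rewrite -mE in_msetD j_m ?orbT.
    apply/allpairsP; exists (m1, m2); rewrite /= !mem_monomials.
    have := size_msetD m1 m2; rewrite mE sz_m sz1 eqxx.
    by case/andP: m_lt' => -> -> dE; split=> //; rewrite dE addKn eqxx.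
  by apply: eq_fsbigl; apply/seteqP; split=> p /= /eqP.
rewrite /eval big_seq; under eq_bigr => m m_d do rewrite mulE //.
case: ifP => i_d; last by rewrite big1 // => m _; rewrite rmorph0 mul0r.
rewrite -big_seq mulr_suml.
under [RHS]eq_bigr do rewrite mulr_sumr.
pose term (p : monomial * monomial) : C :=
  ratr (F p.1) * eval_monomial p.1 * (ratr (G p.2) * eval_monomial p.2).
rewrite -[RHS](big_allpairs (F := term)).
under eq_bigr => m _ do rewrite rmorph_sum mulr_suml.
rewrite (exchange_big_dep xpredT) //= big_seq [RHS]big_seq.
apply: eq_bigr => -[m1 m2] /allpairsP[[m1' m2'] /= [m1_i m2_d [-> ->]]].
rewrite sum_pred1_uniq ?undup_uniq //.
  by rewrite rmorphM eval_monomialD mulrACA.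
move: m1_i m2_d; rewrite !mem_monomials size_msetD.
case/andP => /eqP-> /allP m1_lt /andP[/eqP-> /allP m2_lt].
rewrite subnKC // eqxx; apply/allP => j; rewrite in_msetD.
by case/orP => [/m1_lt|/m2_lt].
Qed.

(** Turns an evaluated sum over a possibly infinite [A] into a finite one: only the
[t] whose monomial involves no variable beyond the alphabet count, and [h]
parametrises them. *)
Lemma eval_monomial_sum (T : choiceType) (I : finType) (h : I -> T)
    (A : set T) (P : pred I) (mu : T -> monomial) d :
  injective h -> (forall i, P i <-> A (h i)) ->
  (forall i, P i -> mu (h i) \in monomials d) ->
  (forall t, A t -> mu t \in monomials d -> exists i, t = h i) ->
  eval d (monomial_sum A mu) = \sum_(i | P i) eval_monomial (mu (h i)).
Proof.
move=> h_inj PA hd hA.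
have sumE m : m \in monomials d ->
    monomial_sum A mu m = \sum_(i | P i && (mu (h i) == m)) 1.
  move=> m_d; pose Q := [pred t | `[< A t >] && (mu t == m)].
  rewrite /monomial_sum; transitivity (\sum_(t \in [set` Q]) (1 : rat)).
    apply: eq_fsbigl; apply/seteqP; split=> t /=.
      by case=> At /eqP tm; apply/andP; split=> //; apply/asboolP.
    by case/andP => /asboolP At /eqP.
  rewrite -(bigfs _ (r := [seq h i | i <- index_enum I])).
  - rewrite big_map; apply: eq_bigl => i /=; congr (_ && _).
    by apply/asboolP/idP => /PA.
  - by rewrite map_inj_uniq ?index_enum_uniq.
  - move=> t /andP[/asboolP At /eqP tm]; case: (hA t At); first by rewrite tm.
    by move=> i ->; rewrite map_f ?mem_index_enum.
rewrite /eval big_seq; under eq_bigr => m m_d do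
  rewrite sumE // rmorph_sum mulr_suml.
rewrite -big_seq (exchange_big_dep P) => [|m i _ /andP[]//] /=.
apply: eq_bigr => i Pi; under eq_bigl do rewrite Pi.
rewrite sum_pred1_uniq ?undup_uniq ?hd //= ?rmorph1 ?mul1r //.
Qed.

Lemma elementary_homogeneous i : homogeneous i (elementary i).
Proof.
move=> m; rewrite /elementary /monomial_sum; apply: contraNeq => sz_m.
apply/eqP/fsbig1 => J /= [Ji Jm]; case/eqP: sz_m.
by rewrite -Jm -Ji (perm_size (perm_eq_seq_mset _)).
Qed.

Lemma var_val (i : 'I_n) : var (val i) = x i.
Proof. by rewrite /var valK. Qed.

Lemma eval_monomial_seq (s : seq nat) : eval_monomial (seq_mset s) = \prod_(j <- s) var j.
Proof. exact/perm_big/perm_eq_seq_mset. Qed.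

Lemma seq_mset_monomials d (s : seq nat) :
  (seq_mset s \in monomials d) = (size s == d) && all (fun j => j < n)%N s.
Proof.
have pm := perm_eq_seq_mset s.
by rewrite mem_monomials (perm_size pm) (perm_all _ pm).
Qed.

Lemma eval_elementary i : eval i (elementary i) = elem_sym x i.
Proof.
pose h (J : {set 'I_n}) : {fset nat} := [fset val j | j in J]%fset.
have hE J : perm_eq (enum_fset (h J)) [seq val j | j <- enum J].
  apply: uniq_perm; rewrite ?fset_uniq ?(map_inj_uniq val_inj) ?enum_uniq //.
  move=> a; apply/imfsetP/mapP => [[j jJ ->]|[j jJ ->]]; exists j => //.
    by rewrite mem_enum.
  by rewrite mem_enum in jJ.
rewrite /elementary (eval_monomial_sum (h := h) (P := fun J => #|J| == i)).
- apply: eq_bigr => J _; rewrite eval_monomial_seq (perm_big _ (hE J)) big_map big_enum /=.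
  by apply: eq_bigr => j _; rewrite var_val.
- move=> J1 J2 J12; apply/setP => j.
  have := perm_mem (hE J1) (val j); rewrite J12 (perm_mem (hE J2)).
  by rewrite !(mem_map val_inj) !mem_enum.
- move=> J /=; have /perm_size := hE J; rewrite size_map -cardE => <-.
  by rewrite cardfE; split=> /eqP.
- move=> J /eqP Ji; rewrite seq_mset_monomials (perm_size (hE J)) (perm_all _ (hE J)).
  rewrite size_map -cardE Ji eqxx all_map.
  by apply/allP => j _ /=.
move=> J Ji; rewrite seq_mset_monomials => /andP[_ /allP J_lt].
exists (finset (fun j : 'I_n => val j \in J)); apply/fsetP => a.
apply/idP/imfsetP => [aJ|[j /= jJ ->]]; last by rewrite inE in jJ.
by exists (Ordinal (J_lt a aJ)) => //=; rewrite inE.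
Qed.

Lemma eval_elementary_prod d (mu : seq nat) :
  eval d (elementary_prod mu) = if sumn mu == d then \prod_(i <- mu) elem_sym x i else 0.
Proof.
rewrite /elementary_prod; elim: mu d => [|i mu IH] d /=.
  by rewrite eval_series1 big_nil eq_sym; case: eqP.
rewrite (eval_mul _ _ (@elementary_homogeneous i)) eval_elementary IH big_cons.
case: ifP => i_d; last by case: eqP => // dE; move: i_d; rewrite -dE leq_addr.
rewrite -(eqn_add2l i) subnKC //.
by case: ifP; rewrite ?mulr0.
Qed.

Definition properb (G : sgraph) (k : {ffun G -> 'I_n}) : bool :=
  [forall u, forall v, adj u v ==> (k u != k v)].

Lemma eval_chromatic (G : sgraph) :
  eval #|G| (chromatic G) = \sum_(k : {ffun G -> 'I_n} | properb k) \prod_v x (k v).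
Proof.
pose h (k : {ffun G -> 'I_n}) : {ffun G -> nat} := [ffun v => val (k v)].
rewrite /chromatic (eval_monomial_sum (h := h) (P := @properb G)).
- apply: eq_bigr => k _; rewrite eval_monomial_seq big_map big_enum /=.
  by apply: eq_bigr => v _; rewrite ffunE var_val.
- move=> k1 k2 /ffunP k12; apply/ffunP => v; apply: val_inj.
  by have := k12 v; rewrite !ffunE.
- move=> k; split=> [/forallP k_proper u v uv|k_proper].
    have /forallP/(_ v)/implyP/(_ uv) := k_proper u.
    by rewrite !ffunE => /eqP kuv /val_inj.
  apply/forallP => u; apply/forallP => v; apply/implyP => uv.
  by apply/eqP => kuv; apply: (k_proper u v uv); rewrite !ffunE kuv.
- move=> k _; rewrite seq_mset_monomials size_map -cardE eqxx all_map.
  by apply/allP => v _; rewrite /= ffunE; exact: ltn_ord.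
move=> k _; rewrite seq_mset_monomials => /andP[_ /allP k_lt].
have {}k_lt v : (k v < n)%N by apply/k_lt/map_f; rewrite mem_enum.
exists [ffun v => Ordinal (k_lt v)]; apply/ffunP => v.
by rewrite !ffunE.
Qed.

End Evaluation.

(** * Refuting e-positivity with two evaluations *)

Lemma mem_leq_sumn (s : seq nat) k : k \in s -> (k <= sumn s)%N.
Proof.
elim: s => //= j s IH; rewrite inE => /orP[/eqP->|/IH]; first exact: leq_addr.
by move/leq_trans; apply; apply: leq_addl.
Qed.

Section Criterion.
Variables (C : numFieldType) (G : sgraph).
Let n := #|G|.

(** On [x] all the terms of a nonnegative [e]-expansion are nonnegative and add up
to [0], so the coefficient of [e_n] vanishes.  On [y] every other [e_mu] of
degree [n] vanishes, since a partition of [n] other than [(n)] has a part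
smaller than [n]; so the evaluation of the chromatic symmetric function would
vanish too. *)
Lemma not_e_positive_eval (x y : 'I_n -> C) :
  (0 < n)%N ->
  (forall k, (k <= n)%N -> 0 <= elem_sym x k) -> elem_sym x n != 0 ->
  eval x n (chromatic G) = 0 ->
  (forall k, (0 < k < n)%N -> elem_sym y k = 0) ->
  eval y n (chromatic G) != 0 ->
  ~ e_positive G.
Proof.
move=> n_gt0 x_ge0 xn_neq0 x0 y0 y_neq0 [P [c [P_ge0 GE]]].
have evalE (z : 'I_n -> C) : eval z n (chromatic G) =
    \sum_(mu <- P | sumn mu == n) ratr (c mu) * \prod_(i <- mu) elem_sym z i.
  rewrite [RHS]big_mkcond /=.
  transitivity (\sum_(mu <- P) ratr (c mu) * eval z n (elementary_prod mu)).
    rewrite {1}/eval; under eq_bigr do rewrite GE rmorph_sum mulr_suml.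
    rewrite exchange_big; apply: eq_bigr => mu _ /=.
    by rewrite mulr_sumr; apply: eq_bigr => m _; rewrite rmorphM mulrA.
  apply: eq_bigr => mu _; rewrite eval_elementary_prod.
  by case: ifP; rewrite ?mulr0.
have part_le (mu : seq nat) i : sumn mu = n -> i \in mu -> (i <= n)%N.
  by move=> <-; apply: mem_leq_sumn.
have c_n : [:: n] \in P -> c [:: n] = 0.
  move=> nP; move: x0; rewrite evalE big_seq_cond => /eqP; rewrite psumr_eq0.
    move/allP => /(_ _ nP); rewrite nP /= addn0 eqxx /= big_seq1 mulf_eq0.
    by rewrite (negPf xn_neq0) orbF fmorph_eq0 => /eqP.
  move=> mu /andP[muP /eqP mu_n]; have [_ c_ge0] := P_ge0 mu muP.
  rewrite mulr_ge0 ?ler0q // big_seq prodr_ge0 // => i i_mu.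
  by apply: x_ge0; apply: part_le mu_n i_mu.
case/eqP: y_neq0; rewrite evalE big_seq_cond big1 // => mu /andP[muP /eqP mu_n].
have [/andP[_ /allP mu_gt0] _] := P_ge0 mu muP.
have [n_mu|n_mu] := boolP (n \in mu); last first.
  case: mu => [|i mu] in muP mu_n mu_gt0 n_mu *.
    by exfalso; move: n_gt0; rewrite -mu_n.
  rewrite big_cons y0 ?mul0r ?mulr0 //.
  have i_mu : i \in i :: mu by rewrite mem_head.
  have := mu_gt0 i i_mu; rewrite /= => ->.
  rewrite ltn_neqAle (part_le _ _ mu_n i_mu) andbT.
  by apply: contraNneq n_mu => <-.
have mu1 : mu = [:: n].
  have pm := perm_to_rem n_mu; have := perm_sumn pm; rewrite mu_n /= => sE.
  have rem0 : rem n mu = [::].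
    case E : (rem n mu) sE => [//|i s] /=.
    have : (0 < i)%N by apply: mu_gt0; apply: (mem_rem (x := n)); rewrite E mem_head.
    by lia.
  by move: pm; rewrite rem0 => /perm_small_eq->.
by rewrite mu1 c_n ?rmorph0 ?mul0r // -mu1.
Qed.

End Criterion.

(** * Summing over the colourings of a leg *)

Section Legs.
Variables (R : comNzRingType) (n : nat) (x : 'I_n -> R).

(** Weighted count of the colourings of a leg of [k] vertices, listed from the
vertex next to the centre, when the centre has colour [c]. *)
Definition leg_sum (k : nat) (c : 'I_n) : R :=
  \sum_(t : k.-tuple 'I_n | path (fun a b => a != b) c t) \prod_(a <- t) x a.

Lemma leg_sum0 c : leg_sum 0 c = 1.
Proof.
rewrite /leg_sum (big_pred1 [tuple]) ?big_nil // => t.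
by rewrite tuple0 /=; apply/esym/eqP/val_inj.
Qed.

Lemma leg_sumS k c : leg_sum k.+1 c = \sum_(b | c != b) x b * leg_sum k b.
Proof.
rewrite /leg_sum (reindex (fun p : 'I_n * k.-tuple 'I_n => [tuple of p.1 :: p.2])) /=; last first.
  exists (fun t => (thead t, [tuple of behead t])) => [[b t] _|t _] /=.
    by congr (_, _); apply: val_inj.
  by apply: val_inj; case/tupleP: t.
under [RHS]eq_bigr do rewrite mulr_sumr.
by rewrite pair_big_dep; apply: eq_bigr => -[b t] _; rewrite big_cons.
Qed.

(** The evaluated chromatic symmetric function of the path with [k.+1] vertices:
[c] is the colour of an end vertex. *)
Definition path_sum (k : nat) : R := \sum_c x c * leg_sum k c.

Fixpoint leg_poly (k : nat) : {poly R} :=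
  if k is k'.+1 then (path_sum k')%:P - 'X * leg_poly k' else 1.

(** Deletion of the edge at the centre: of all colourings of the leg, those whose
first vertex has the colour [c] of the centre are to be removed. *)
Lemma horner_leg_poly k c : (leg_poly k).[x c] = leg_sum k c.
Proof.
elim: k c => [|k IH] c /=; first by rewrite hornerC leg_sum0.
rewrite hornerD hornerN hornerC mulrC hornerMX IH leg_sumS /path_sum.
by rewrite (bigD1 c) //= mulrC addrAC subrr add0r; apply: eq_bigl => b; rewrite eq_sym.
Qed.

Lemma size_leg_poly k : (size (leg_poly k) <= k.+1)%N.
Proof.
elim: k => [|k IH] /=; first by rewrite size_poly1.
rewrite (leq_trans (size_polyD _ _)) // geq_max (leq_trans (size_polyC_leq1 _)) //=.
rewrite size_polyN mulrC.
by have [->|/size_mulX->] := eqVneq (leg_poly k) 0; rewrite ?mul0r ?size_poly0.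
Qed.

(** If the leg of [k] vertices contributes [(- x_c)^k], then the path with [k.+1]
vertices contributes [(-1)^k p_(k+1)], which is [0] while [k < a]. *)
Lemma leg_polyXn a : (forall j, (0 < j <= a)%N -> power_sum x j = 0) ->
  forall k, (k <= a)%N -> leg_poly k = (- 'X) ^+ k.
Proof.
move=> pa; elim=> [|k IH] k_a //=; rewrite IH ?(ltnW k_a) // exprS mulNr.
suff -> : path_sum k = 0 by rewrite polyC0 add0r.
rewrite /path_sum; under eq_bigr do
  rewrite -horner_leg_poly IH ?(ltnW k_a) // horner_exp hornerN hornerX exprNn mulrCA -exprS.
by rewrite -mulr_sumr -/(power_sum x k.+1) pa ?mulr0.
Qed.

Lemma sum_horner (p : {poly R}) :
  \sum_c p.[x c] = \sum_(k < size p) p`_k * power_sum x k.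
Proof.
under eq_bigr do rewrite horner_coef.
by rewrite exchange_big; apply: eq_bigr => k _; rewrite -mulr_sumr.
Qed.

End Legs.

(** * Colourings of spiders *)

Lemma card_spider (la : seq nat) : #|spider la| = (sumn la).+1.
Proof.
rewrite /= card_option card_tagged sumnE big_map big_enum /= sumnE.
rewrite [in RHS](big_nth 0%N) big_mkord; congr _.+1.
by apply: eq_bigr => k _; rewrite card_ord.
Qed.

Lemma prod_spider (R : comNzRingType) (la : seq nat) (F : spider la -> R) :
  \prod_v F v = F None *
    \prod_(k < size la) \prod_(j < nth 0%N la k) F (Some (Tagged _ j)).
Proof.
rewrite (bigD1 None) //=; congr (_ * _).
rewrite (reindex_omap Some id) /=; last by case.
by rewrite sig_big_dep; apply: eq_big => [u|[k j] _]; rewrite ?eqxx.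
Qed.

Section SpiderColourings.
Variables (R : comNzRingType) (n : nat) (x : 'I_n -> R) (la : seq nat).

Let leg_colours (k : 'I_(size la)) : finType := (nth 0%N la k).-tuple 'I_n.

(** A colouring of the spider is a colour of the centre with one word per leg.  The
words have different lengths, hence the dependent product [fprod]. *)
Definition glue (p : 'I_n * fprod leg_colours) : {ffun spider la -> 'I_n} :=
  [ffun v : spider la => if v is Some u then tnth (p.2 (tag u)) (tagged u) else p.1].

Lemma glue_bij : bijective glue.
Proof.
exists (fun f : {ffun spider la -> 'I_n} =>
  (f None, fprod_of_fun (fun k => [tuple f (Some (Tagged _ j)) | j < nth 0%N la k]
                         : leg_colours k))).
  move=> [c g] /=; rewrite ffunE; congr (_, _); apply/fprodP => k.
  by rewrite fprodE; apply: eq_from_tnth => j; rewrite tnth_mktuple ffunE.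
move=> f; apply/ffunP => -[[k j]|]; rewrite ffunE //=.
by rewrite fprodE tnth_mktuple.
Qed.

Lemma proper_glue p : properb (glue p) =
  [forall k, path (fun a b => a != b) p.1 (p.2 k : leg_colours k)].
Proof.
case: p => c g /=; apply/forallP/forallP => [gP k|gP u].
  apply/(pathP c) => j; rewrite size_tuple => j_k.
  have jE : nth c (g k) j = tnth (g k) (Ordinal j_k) by rewrite (tnth_nth c).
  case: j j_k jE => [|j] j_k jE; rewrite [nth c _ _ in X in _ != X]jE.
    have /forallP/(_ (Some (Tagged _ (Ordinal j_k))))/implyP/(_ isT) := gP None.
    by rewrite !ffunE.
  have j_k' : (j < nth 0%N la k)%N by apply: ltnW.
  have /forallP/(_ (Some (Tagged _ (Ordinal j_k))))/implyP := gP (Some (Tagged _ (Ordinal j_k'))).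
  rewrite !ffunE /= !eqxx /= (tnth_nth c) => /(_ isT).
  by rewrite (tnth_nth c).
apply/forallP => v; apply/implyP; rewrite !ffunE.
have first_leg (w : {k : 'I_(size la) & 'I_(nth 0%N la k)}) :
    tagged w == 0%N :> nat -> c != tnth (g (tag w)) (tagged w).
  case: w => k j /= /eqP j0; have /(pathP c)/(_ 0%N) := gP k.
  by rewrite size_tuple (tnth_nth c) j0; apply; apply: leq_ltn_trans (ltn_ord j).
have next_leg (k : 'I_(size la)) (i j : 'I_(nth 0%N la k)) :
    i.+1 = j :> nat -> tnth (g k) i != tnth (g k) j.
  move=> ij; have /(pathP c)/(_ j) := gP k.
  by rewrite size_tuple !(tnth_nth c) -ij /=; apply; rewrite ij.
case: u v => [[k i]|] [[l j]|] //=.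
- case/andP => /eqP kl; case: l / kl j => j /=.
  case/orP => /eqP; first exact: next_leg.
  by move/next_leg; rewrite eq_sym.
- by move=> i0; rewrite eq_sym; exact: (first_leg (existT _ k i) i0).
- by move=> j0; exact: (first_leg (existT _ l j) j0).
Qed.

(** Once the centre is coloured, the legs are coloured independently. *)
Lemma spider_sum :
  \sum_(f : {ffun spider la -> 'I_n} | properb f) \prod_v x (f v)
  = \sum_c x c * \prod_(k <- la) leg_sum x k c.
Proof.
rewrite (reindex glue) /=; last exact/onW_bij/glue_bij.
pose w c (k : 'I_(size la)) : {ffun leg_colours k -> R} :=
  [ffun t : leg_colours k => if path (fun a b => a != b) c t then \prod_(a <- t) x a else 0].
transitivity (\sum_(p : 'I_n * fprod leg_colours) x p.1 * \prod_k w p.1 k (p.2 k)).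
  rewrite big_mkcond; apply: eq_bigr => p _; rewrite proper_glue.
  case: ifP => [/forallP pP|/negbT]; last first.
    rewrite negb_forall => /existsP[k /negPf kP].
    by rewrite (bigD1 k) //= ffunE kP mul0r mulr0.
  rewrite prod_spider ffunE; congr (_ * _); apply: eq_bigr => k _.
  rewrite ffunE pP big_tuple; apply: eq_bigr => j _.
  by rewrite ffunE.
rewrite -(pair_bigA _ (fun c (g : fprod leg_colours) => x c * \prod_k w c k (g k))) /=.
apply: eq_bigr => c _; rewrite -mulr_sumr; congr (_ * _).
rewrite big_fprod (big_nth 0%N) big_mkord.
rewrite -(bigA_distr_big_dep (fun k => tagged_with leg_colours k) (fun k => untag 0 (w c k))).
apply: eq_bigr => k _; rewrite /leg_sum [RHS]big_mkcond.
transitivity (\sum_(t : leg_colours k) w c k t); last first.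
  by apply: eq_bigr => t _; rewrite ffunE.
by rewrite (big_tag (fun k => w c k)); apply: eq_bigl.
Qed.

End SpiderColourings.

(** * Spiders that are not e-positive *)

Section SpiderPoly.
Variables (R : comNzRingType) (n : nat) (x : 'I_n -> R).

Definition spider_poly (la : seq nat) : {poly R} := 'X * \prod_(k <- la) leg_poly x k.

Lemma size_prod_leg_poly (s : seq nat) :
  (size (\prod_(k <- s) leg_poly x k)%R <= (sumn s).+1)%N.
Proof.
elim: s => [|k s IH]; first by rewrite big_nil size_poly1.
rewrite big_cons (leq_trans (size_polyMleq _ _)) //=.
rewrite -subn1 leq_subLR (leq_trans (leq_add (size_leg_poly x k) IH)) //.
by rewrite addSn addnS.
Qed.

Lemma prod_leg_polyXn a (s : seq nat) :
  (forall j, (0 < j <= a)%N -> power_sum x j = 0) ->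
  all (fun k => k <= a)%N s ->
  \prod_(k <- s) leg_poly x k = (- 'X) ^+ sumn s.
Proof.
move=> pa; elim: s => [|k s IH] /=; first by rewrite big_nil expr0.
by case/andP => k_a /IH sE; rewrite big_cons (leg_polyXn pa k_a) sE exprD.
Qed.

Lemma spider_sum_poly (la : seq nat) :
  \sum_c x c * \prod_(k <- la) leg_sum x k c = \sum_c (spider_poly la).[x c].
Proof.
apply: eq_bigr => c _; rewrite /spider_poly hornerM hornerX horner_prod.
by congr (_ * _); apply: eq_bigr => k _; rewrite horner_leg_poly.
Qed.

End SpiderPoly.

(** The first alphabet has its nonzero power sums, among [p_1, ..., p_n], in the
degrees [a+1, ..., a+t], while the short legs, those in [s2], push every degree
that occurs in the evaluation above [a+t].  The second alphabet has [p_n] as its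
only nonzero power sum among [p_1, ..., p_n]. *)
Lemma spider_not_e_positive (s1 s2 : seq nat) (a t q : nat) :
  all (fun k => k <= a)%N s2 -> (a + t <= sumn s2)%N ->
  (q * a.+1 <= (sumn (s1 ++ s2)).+1 <= q * (a + t))%N ->
  ~ e_positive (spider (s1 ++ s2)).
Proof.
set la := s1 ++ s2 => s2_a s2_t n_q.
have nE := card_spider la; set n := #|spider la| in nE *.
have n_gt0 : (0 < n)%N by rewrite nE.
rewrite -nE in n_q.
pose Kx j := (a < j <= a + t)%N; pose Ky j := j == n.
have ex_gt0 : 0 < spec_elem algC Kx n by apply: (@spec_elem_gt0_sum _ _ a.+1 (a + t) q).
have ey_gt0 : 0 < spec_elem algC Ky n.
  apply: (@spec_elem_gt0_sum _ _ n n 1) => //; last by rewrite !mul1n leqnn.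
  by move=> j; rewrite -eqn_leq eq_sym.
have [x xE] := spec_alphabet n_gt0 (lt0r_neq0 ex_gt0).
have [y yE] := spec_alphabet n_gt0 (lt0r_neq0 ey_gt0).
have px := spec_power_sum xE; have py := spec_power_sum yE.
apply: (not_e_positive_eval (x := x) (y := y)) => //.
- by move=> k k_n; rewrite xE ?spec_elem_ge0.
- by rewrite xE ?lt0r_neq0.
- rewrite eval_chromatic spider_sum spider_sum_poly sum_horner.
  have px0 j : (0 < j <= a)%N -> (j <= n)%N -> power_sum x j = 0.
    case: j => // j ja jn; rewrite px // /Kx (_ : (a < j.+1)%N = false) ?mulr0 //.
    by apply/negbTE; rewrite -leqNgt.
  have sE : \prod_(k <- s2) leg_poly x k = (- 'X) ^+ sumn s2.
    apply: (prod_leg_polyXn _ s2_a) => j ja; apply: px0 => //.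
    have : (sumn s2 < n)%N by rewrite nE ltnS sumn_cat leq_addl.
    by lia.
  apply: big1 => -[k k_lt] _ /=.
  have k_n : (k <= n)%N.
    rewrite -ltnS; apply: leq_trans k_lt _.
    rewrite /spider_poly (leq_trans (size_polyMleq _ _)) // size_polyX nE.
    exact: size_prod_leg_poly.
  (* The factor ['X] of the centre and the legs in [s2] make the polynomial
     divisible by ['X^(sumn s2).+1]. *)
  have [k_s2|k_s2] := leqP k (sumn s2).
    rewrite /spider_poly big_cat /= sE exprNn [\prod_(_ <- _) _ * _]mulrA.
    by rewrite mulrCA -exprS coefMXn ltnS k_s2 mul0r.
  have k_gt0 : (0 < k)%N by lia.
  case: k k_gt0 {k_lt} k_n k_s2 => // k' _ k_n k_s2.
  rewrite px // /Kx [(k'.+1 <= _)%N]leqNgt (leq_ltn_trans s2_t k_s2).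
  by rewrite andbF !mulr0.
- by move=> k /andP[k_gt0 k_n]; rewrite yE ?(ltnW k_n) // spec_elem_eq0 // => j ?; rewrite /Ky; lia.
rewrite eval_chromatic spider_sum spider_sum_poly /spider_poly.
rewrite (@prod_leg_polyXn _ _ y (sumn la)).
- have -> : \sum_c ('X * (- 'X) ^+ sumn la).[y c] = (-1) ^+ sumn la * power_sum y (sumn la).+1.
    rewrite mulr_sumr; apply: eq_bigr => c _.
    by rewrite hornerM hornerX horner_exp hornerN hornerX (exprNn (y c)) (exprS (y c)) mulrCA.
  by rewrite py ?nE // /Ky -nE eqxx mulr1 -expr2 sqrr_sign oner_neq0.
- move=> [|j] // j_la; have j_n : (j.+1 < n)%N by rewrite nE ltnS.
  by rewrite py ?(ltnW j_n) // /Ky ltn_eqF // mulr0.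
by apply/allP => k; apply: mem_leq_sumn.
Qed.

Lemma part_tailE la i : part_tail la i = sumn (drop i la).
Proof.
rewrite /part_tail big_add1 /= sumnE [RHS](big_nth 0%N) size_drop -[i in LHS]add0n big_addn.
by apply: eq_bigr => j _; rewrite nth_drop /part /= addnC.
Qed.

Lemma spider_not_e_positive_part (la : seq nat) (i q : nat) :
  is_partition la -> (0 < i <= size la)%N ->
  (q * (part la i).+1 <= (sumn la).+1 <= q * (part la i + part_tail la i))%N ->
  ~ e_positive (spider la).
Proof.
case/andP => la_sorted _; case: i => // i /= i_la n_q.
have dE := drop_nth 0%N i_la.
rewrite -(cat_take_drop i la).
apply: (@spider_not_e_positive _ _ (part la i.+1) (part_tail la i.+1) q).
- have := drop_sorted i la_sorted; rewrite dE /= path_sortedE => [/andP[le_a _]|? ? ? /=].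
    by rewrite leqnn.
  by move=> ? ?; lia.
- by rewrite dE part_tailE.
by rewrite cat_take_drop.
Qed.

(** For [n = q (a+1) + r] with [r <= a], the upper bound amounts to
[r <= q (t-1)], which holds as [a <= 2 (a-1) <= q (t-1)]. *)
Lemma exists_multiplier (n a t : nat) : (2 <= a <= t)%N -> (a.+1.*2 <= n)%N ->
  exists q, (q * a.+1 <= n <= q * (a + t))%N.
Proof.
move=> a_t n_a; exists (n %/ a.+1)%N; rewrite leq_trunc_div /=.
have q2 : (2 <= n %/ a.+1)%N by rewrite leq_divRL // mul2n.
have r_a : (n %% a.+1 <= a)%N by rewrite -ltnS ltn_pmod.
have := divn_eq n a.+1; nia.
Qed.

Local Close Scope ring_scope.

Theorem proposition33 (n : nat) (la : seq nat)
  (la_partition : is_partition la)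
  (n_vertices : n = (sumn la).+1)
  (d_ge3 : 3 <= size la)
  (criteria :
    [\/ [/\ part_tail la 1 <= part la 1,
            part la 2 <= part_tail la 2,
            2 <= part la 2
          & 3 <= part la 2 \/
            (part la 2 = 2 /\
             exists q r : nat,
               [/\ n = q * (part la 2 + 1) + r, r < part la 2 + 1 & 3 <= q])],
        exists i : nat,
          [/\ 3 <= i < size la,
              2 <= part la i,
              part la i <= part_tail la i
            & forall j : nat, 1 <= j < i -> part_tail la j < part la j]
      | exists i : nat,
          [/\ 2 <= i < size la,
              1 < part_tail la i
            & exists q r : nat,
                [/\ n = q * (part la i + 1) + r, r < part la i + 1
                  & ((part la i + 1)%:R / ((part_tail la i)%:R - 1)
                       <= q%:R :> rat)%R]]]) :
  ~ e_positive (spider la).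
Proof.
rewrite n_vertices in criteria.
have nE : sumn la = (part la 1 + part_tail la 1)%N.
  rewrite part_tailE; case: la d_ge3 {la_partition n_vertices criteria} => //= k s _.
  by rewrite drop0.
have tail_ge i : 2 <= i <= size la -> part la i + part_tail la i <= part_tail la 1.
  case: i => [|[|i]] // /andP[_ i_la]; rewrite !part_tailE -[_ + _]/(sumn (_ :: _)).
  rewrite -drop_nth //= -[in X in _ <= X](cat_take_drop i (drop 1 la)) sumn_cat.
  by rewrite drop_drop addn1 leq_addl.
(* The common core of the first two criteria: the first leg is at least as long
   as all the others together, so that [n > 2 (a + t) >= 4 a]. *)
have not_e_positive_if i : 2 <= i < size la -> 2 <= part la i ->
    part la i <= part_tail la i -> part_tail la 1 <= part la 1 ->
    ~ e_positive (spider la).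
  move=> i_la a2 a_t l1.
  have [i1 i2] : 2 <= i <= size la /\ 0 < i <= size la by lia.
  have tail_i := tail_ge i i1.
  have [||q qP] := @exists_multiplier (sumn la).+1 (part la i) (part_tail la i); [lia..|].
  exact: (@spider_not_e_positive_part la i q).
case: criteria => [[l1 l2 l3 _]|[i [i_la a2 a_t l1]]|[i [i_la t_gt1 [q [r [nq r_a q_ge]]]]]].
- by apply: (not_e_positive_if 2) => //; rewrite d_ge3.
- by apply: (not_e_positive_if i) => //; [lia | apply/ltnW/l1; lia].
apply: (@spider_not_e_positive_part la i q) => //; first lia.
(* The third criterion says that [a + 1 <= q (t - 1)], hence [r <= q (t - 1)]. *)
have {}q_ge : part la i + 1 <= q * (part_tail la i - 1).
  move: q_ge; rewrite ler_pdivrMr ?subr_gt0 ?ltr1n // -(natrB _ (ltnW t_gt1)).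
  by rewrite -natrM ler_nat.
by rewrite nq; nia.
Qed.
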